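(* Let $R$ be a maximal subring of a ring $T$. Assume that $\mathrm{Char}(T)$ is neither zero nor a prime number. Then $(R:T)\neq 0$.
   Context: All rings are associative, unital with $1\neq 0$, and not necessarily commutative; subrings contain the identity of the overring. A subring $R\subsetneq T$ is a maximal subring of $T$ if there is no subring $S$ with $R\subsetneq S\subsetneq T$. $(R:T):=\{x\in T\mid TxT\subseteq R\}$ is the largest two-sided ideal of $T$ contained in $R$. $\mathrm{Char}(T)$ is the characteristic of $T$. *)

(* Defs.v *)
From mathcomp Require Import all_boot all_order all_algebra.
From mathcomp Require Import boolp classical_sets.

Set Implicit Arguments.
Unset Strict Implicit.
Unset Printing Implicit Defensive.

Import GRing.Theory.
Local Open Scope classical_set_scope.
Local Open Scope ring_scope.

(* Subrings are arbitrary (not necessarily decidable) subsets of the carrier;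
   [in R] turns such a set into the predicate expected by subring_closed. *)
Definition is_subring (T : nzRingType) (R : set T) : Prop :=
  subring_closed [in R].

Definition maximal_subring (T : nzRingType) (R : set T) : Prop :=
  [/\ is_subring R, R `<` [set: T] &
      ~ exists S : set T, [/\ is_subring S, R `<` S & S `<` [set: T]]].

Definition conductor (T : nzRingType) (R : set T) : set T :=
  [set x | [set t * x * u | t in [set: T] & u in [set: T]] `<=` R].

(* The library's [pchar T] only records the prime n with n%:R = 0, so it does
   not determine a composite characteristic. *)
Definition characteristic (T : nzRingType) : nat :=
  if pselect (exists n, (0 < n)%N && (n%:R == 0 :> T)) is left ex_n
  then ex_minn ex_n else 0%N.

Lemma dvdn_characteristic (T : nzRingType) (m : nat) :
  (characteristic T %| m)%N = (m%:R == 0 :> T).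
Proof.
rewrite /characteristic; case: pselect => [ex_n | no_n].
  case: ex_minnP => n /andP[n_gt0 /eqP n0] n_min.
  have mE : m%:R = (m %% n)%:R :> T.
    by rewrite {1}(divn_eq m n) natrD natrM n0 mulr0 add0r.
  rewrite mE; apply/idP/idP => [/eqP-> // | r0].
  rewrite /dvdn eqn0Ngt; apply/negP => r_gt0.
  by have := n_min _ (introT andP (conj r_gt0 r0)); rewrite leqNgt ltn_mod n_gt0.
rewrite dvd0n; apply/idP/idP => [/eqP-> // | m0].
by rewrite eqn0Ngt; apply/negP => m_gt0; apply: no_n; exists m; rewrite m_gt0.
Qed.

(* Main.v *)
Require Import Defs.
From mathcomp Require Import all_boot all_order all_algebra.
From mathcomp Require Import boolp classical_sets.

(** Write the characteristic as [n = p * m] with [1 < p, m < n].  Since [p T] is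
    a two-sided ideal, [R + p T] is a subring containing [R], so maximality
    leaves two cases ([maximal_subring_mulrn]).  Either [p T] is contained in
    [R], and the conductor contains the nonzero element [p]; or [T = R + p T],
    and then [m T = m R + n T = m R] is contained in [R], so the conductor
    contains the nonzero element [m]. *)

Import GRing.Theory.
Local Open Scope classical_set_scope.
Local Open Scope ring_scope.

Lemma is_subringP (T : nzRingType) (R : set T) :
  is_subring R <->
  [/\ R 1, forall x y, R x -> R y -> R (x - y)
    & forall x y, R x -> R y -> R (x * y)].
Proof.
split=> [[R1 RB RM] | [R1 RB RM]].
  split=> [|x y Rx Ry|x y Rx Ry]; apply/set_mem => //.
    by apply: RB; apply/mem_set.
  by apply: RM; apply/mem_set.
split=> [|x y /set_mem Rx /set_mem Ry|x y /set_mem Rx /set_mem Ry].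
- exact/mem_set.
- exact/mem_set/RB.
- exact/mem_set/RM.
Qed.

Lemma subring_mulrn (T : nzRingType) (R : set T) (x : T) (k : nat) :
  is_subring R -> R x -> R (x *+ k).
Proof.
move=> /is_subringP[R1 RB _] Rx.
have R0 : R 0 by rewrite -(subrr 1); apply: RB.
elim: k => [|k IHk]; first by rewrite mulr0n.
have -> : x *+ k.+1 = x *+ k - (0 - x) by rewrite sub0r opprK mulrSr.
by apply: (RB) => //; apply: RB.
Qed.

(** The set [R + k T]. *)
Definition add_multiples (T : nzRingType) (R : set T) (k : nat) : set T :=
  [set x | exists r t, R r /\ x = r + t *+ k].

Lemma sub_add_multiples (T : nzRingType) (R : set T) (k : nat) :
  R `<=` add_multiples T R k.
Proof. by move=> r Rr; exists r, 0; rewrite mul0rn addr0. Qed.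

Lemma add_multiples_subring (T : nzRingType) (R : set T) (k : nat) :
  is_subring R -> is_subring (add_multiples T R k).
Proof.
move=> /is_subringP[R1 RB RM]; apply/is_subringP; split.
- exact: sub_add_multiples.
- move=> _ _ [r [t [Rr ->]]] [s [u [Rs ->]]].
  exists (r - s), (t - u); split; first exact: RB.
  by rewrite mulrnBl opprD addrACA.
- move=> _ _ [r [t [Rr ->]]] [s [u [Rs ->]]].
  exists (r * s), (r * u + t * (s + u *+ k)); split; first exact: RM.
  by rewrite mulrDl mulrDr mulrnDl mulrnAr mulrnAl addrA.
Qed.

Lemma maximal_subring_mulrn (T : nzRingType) (R : set T) (k : nat) :
  maximal_subring R ->
  (forall t, R (t *+ k)) \/ add_multiples T R k = [set: T].
Proof.
move=> [subR _ noS].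
have [|neqT] := pselect (add_multiples T R k = [set: T]); first by right.
left=> t; apply: contrapT => nRt; apply: noS; exists (add_multiples T R k).
have /is_subringP[R1 RB _] := subR.
split; first exact: add_multiples_subring.
- rewrite properEneq; split; last exact: sub_add_multiples.
  apply/eqP => eqR; apply: nRt; rewrite eqR; exists 0, t.
  by rewrite add0r; split=> //; rewrite -(subrr 1); apply: RB.
- by rewrite properEneq; split; first exact/eqP.
Qed.

Lemma conductor_natr (T : nzRingType) (R : set T) (k : nat) :
  (forall t, R (t *+ k)) -> conductor R k%:R.
Proof.
move=> Rk _ [t _ [u _ <-]].
by rewrite mulr_natr mulrnAl.
Qed.

Lemma natr_neq0_characteristic (T : nzRingType) (k : nat) :
  (0 < k < characteristic T)%N -> k%:R <> 0 :> T.
Proof.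
move=> /andP[k_gt0 k_lt] /eqP; rewrite -dvdn_characteristic => /dvdn_leq.
by move=> /(_ k_gt0); rewrite leqNgt k_lt.
Qed.

Theorem corollary2p21 (T : nzRingType) (R : set T)
    (maxR : maximal_subring R)
    (char_neq0 : characteristic T <> 0%N)
    (char_nprime : ~ prime (characteristic T)) :
  conductor R <> [set 0].
Proof.
set n := characteristic T in char_neq0 char_nprime.
have n0 : n%:R = 0 :> T by apply/eqP; rewrite -dvdn_characteristic.
have n_gt1 : (1 < n)%N.
  case: n char_neq0 n0 {char_nprime} => [|[|//]] // _ /eqP.
  by rewrite mulr1n oner_eq0.
have [p [m [nE p_bd m_bd]]] :
    exists p m, [/\ n = (m * p)%N, (0 < p < n)%N & (0 < m < n)%N].
  have n_gt0 := ltnW n_gt1; have p_pr := pdiv_prime n_gt1.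
  exists (pdiv n), (n %/ pdiv n)%N; rewrite divnK ?pdiv_dvd //.
  rewrite divn_gt0 ?prime_gt0 // pdiv_leq // ltn_Pdiv ?prime_gt1 //.
  rewrite ltn_neqAle pdiv_leq // andbT; split=> //.
  by apply/eqP => pE; apply: char_nprime; rewrite -pE.
suff [k k_bd Rk] : exists2 k, (0 < k < n)%N & forall t, R (t *+ k).
  move=> cond0; apply: (natr_neq0_characteristic T k k_bd).
  by have := conductor_natr T R k Rk; rewrite cond0.
have [Rp | RpT] := maximal_subring_mulrn T R p maxR; first by exists p.
exists m => // t; have : add_multiples T R p t by rewrite RpT.
case=> r [s [Rr ->]].
have -> : (r + s *+ p) *+ m = r *+ m.
  by rewrite mulrnDl -mulrnA mulnC -nE -[s *+ n]mulr_natr n0 mulr0 addr0.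
by case: maxR => subR _ _; apply: subring_mulrn.
Qed.
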